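(* Let $R=\mathbb{Q}[x_1,\ldots,x_n]$, let $B\subseteq R^s$ be a submodule, and let $M\subseteq B$ be a submodule with an irredundant primary decomposition $M=Q_1\cap Q_2\cap\cdots\cap Q_m$ in $B$, where $Q_i$ is $P_i$-primary in $B$, i.e. $P_i=\sqrt{\operatorname{Ann}(B/Q_i)}$. Let $P\in\{P_1,\ldots,P_m\}$ and let $Q\subseteq B$ be a $P$-primary submodule of $B$ such that $M\subseteq Q$. Then $Q$ is a primary component for $M$, i.e. there exists $i\in\{1,\ldots,m\}$ such that $$M=Q_1\cap\cdots\cap Q_{i-1}\cap Q\cap Q_{i+1}\cap\cdots\cap Q_m,$$ if and only if $$Q\cap (M_{[P]}:P^\infty)=M_{[P]}.$$
   Context: All modules are finitely generated. A (proper) submodule $N\subset B$ is a primary submodule of $B$ if for all $r\in R$, $v\in B$ with $rv\in N$ one has $v\in N$ or $r\in\sqrt{\operatorname{Ann}(B/N)}$; then $P=\sqrt{\operatorname{Ann}(B/N)}$ is a prime ideal and $N$ is called $P$-primary in $B$. A primary decomposition of $M$ in $B$ is an expression $M=\bigcap_{i=1}^m Q_i$ with each $Q_i$ a $P_i$-primary submodule of $B$. It is irredundant (reduced) if no $Q_i$ contains $\bigcap_{j\ne i}Q_j$ and the primes $P_1,\ldots,P_m$ are pairwise distinct. For $b\in B$, $(M:b)=\{r\in R: rb\in M\}$. For a prime ideal $P$ of $R$, the localization of $M$ at $P$ (inside $B$) is $M_{[P]}=\{b\in B:\dim(P+(M:b))<\dim P\}=\{b\in B:(M:b)\not\subseteq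 P\}$, where the dimension of an ideal $I$ means the Krull dimension of $R/I$. Equivalently, $M_{[P]}$ is the preimage of the usual localization $M_P\subseteq B_P$ under the canonical map $B\to B_P$. For a submodule $A\subseteq B$ and an ideal $J$ of $R$, $(A:J^\infty)=\{b\in B: J^k b\subseteq A \text{ for some } k\ge 1\}$. *)

(* Defs.v *)
From HB Require Import structures.
From mathcomp Require Import all_boot all_order all_algebra ring_quotient.
From mathcomp Require Import boolp classical_sets.
From mathcomp Require Import mpoly.

Set Implicit Arguments.
Unset Strict Implicit.
Unset Printing Implicit Defensive.

Import GRing.Theory.
Local Open Scope classical_set_scope.
Local Open Scope ring_scope.

Section Ideals.
Variable R : comNzRingType.
Implicit Types I J P : set R.

(* [idealr_closed] includes 1 \notin P, so prime ideals are proper. *)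
Definition is_prime_ideal P : Prop :=
  idealr_closed [pred r in P] /\ prime_idealr_closed [pred r in P].

Definition ideal_add I J : set R := [set r + t | r in I & t in J].

Definition ideal_mul I J : set R :=
  [set r | exists (k : nat) (f g : 'I_k -> R),
     [/\ forall i, I (f i), forall i, J (g i) & r = \sum_(i < k) f i * g i]].

Definition ideal_exp J (k : nat) : set R := iter k (ideal_mul J) setT.

Definition radical I : set R := [set r | exists k : nat, I (r ^+ k)].

(* dim (R/I) >= d: the primes of R/I correspond to the primes of R containing
   I, so this asks for a chain p 0 < p 1 < ... < p d of such primes.  It fails
   for every d when I = R. *)
Definition krull_dim_ge I (d : nat) : Prop :=
  exists p : nat -> set R,
    [/\ forall i, (i <= d)%N -> is_prime_ideal (p i),
        forall i, (i <= d)%N -> I `<=` p i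
      & forall i, (i < d)%N -> p i `<` p i.+1].

(* dim (R/I) < dim (R/J), with dimensions in {-oo} U nat U {+oo} and the zero
   ring of dimension -oo. *)
Definition krull_dim_lt I J : Prop :=
  exists d, krull_dim_ge J d /\ ~ krull_dim_ge I d.

End Ideals.

Section Submodules.
Variables (R : comNzRingType) (V : lmodType R).
Implicit Types A B M N Q : set V.

Definition is_submodule A : Prop := GRing.submod_closed [pred v in A].

Definition ann_quotient B N : set R :=
  [set r | forall v, B v -> N (r *: v)].

Definition is_primary_submodule B N : Prop :=
  [/\ is_submodule N, N `<` B
    & forall r v, B v -> N (r *: v) -> N v \/ radical (ann_quotient B N) r].

Definition is_P_primary B (P : set R) N : Prop :=
  is_primary_submodule B N /\ P = radical (ann_quotient B N).

Definition is_primary_decomposition B M (m : nat)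
    (Q : 'I_m -> set V) (P : 'I_m -> set R) : Prop :=
  (forall i, is_P_primary B (P i) (Q i)) /\ M = B `&` \bigcap_i Q i.

(* The intersections are taken inside B, so that the empty one is B. *)
Definition is_irredundant_primary_decomposition B M (m : nat)
    (Q : 'I_m -> set V) (P : 'I_m -> set R) : Prop :=
  [/\ is_primary_decomposition B M Q P,
      forall i, ~ (B `&` \bigcap_(j in [set j | j != i]) Q j `<=` Q i)
    & injective P].

Definition colon M (b : V) : set R := [set r | M (r *: b)].

(* M_[P], the localization of M at P inside B. *)
Definition localization B M (P : set R) : set V :=
  [set b | B b /\ krull_dim_lt (ideal_add P (colon M b)) P].

Definition saturation B A (J : set R) : set V :=
  [set b | B b /\ exists k : nat, (1 <= k)%N /\
     (forall r, ideal_exp J k r -> A (r *: b))].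

End Submodules.

(* Main.v *)
Require Import Defs.
From HB Require Import structures.
From mathcomp Require Import all_boot all_order all_algebra ring_quotient.
From mathcomp Require Import boolp classical_sets.
From mathcomp Require Import mpoly.

(** Write [MP] for the localization [M_[P]].  The statement holds over every
    commutative ring, provided that [P] is finitely generated and [R/P] has
    finite Krull dimension; polynomial rings over a field satisfy both.

    When [R/P] has finite dimension, [dim (P + I) < dim P] says exactly that
    [I] is not contained in [P], because a chain of primes above an ideal
    strictly larger than [P] can be prolonged by [P] ([krull_dim_lt_addP]).  So
    [MP] consists of the [b] such that [r b] lies in [M] for some [r] outside
    [P]; it is contained in each [Q_j] with [P_j <= P], and contains the
    intersection of these [Q_j] ([localization_sub_primary],
    [mem_localization]).

    Suppose that replacing [Q_i] by [Q] still decomposes [M].  Choosing [b] in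
    all the [Q_j] with [j != i] but not in [Q_i], the radical of [(M : b)] is
    [P_i] according to the first decomposition and [P] according to the second,
    hence [P_i = P] ([primary_component_prime]).  Thus [Q] is the component at
    [P] of a primary decomposition of [M] with the primes [P_1, ..., P_m], and
    such a component meets [(MP : P^oo)] in [MP]: if [P^e b] lies in [MP] and
    [P_j] is strictly contained in [P], an element of [P] outside [P_j] shows
    that [b] lies in [Q_j] ([component_cap_saturation]).

    Conversely, let [P = P_k] and let [b] be in [Q] and in all the [Q_j] with
    [j != k].  As [P] is finitely generated, some power [P^e] maps [B] into
    [Q_k] ([radical_power_sub]), so [P^e b] lies in [M]; hence [b] lies in
    [Q] and in [(MP : P^oo)], thus in [MP] by hypothesis, and [MP] is contained
    in [Q_k] ([primary_component_iff]).

    For polynomial rings, finite generation is Hilbert's basis theorem, proved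
    by cancelling leading monomials, which Dickson's lemma makes possible in
    any infinite sequence ([mpoly_noetherian]).  That chains of primes in [n]
    variables have length at most [n] is proved by taking one element [x_j] in
    each step of a longer chain: these [n + 1] polynomials are algebraically
    dependent, and the lexicographically lowest term of a relation between them
    puts a nonzero constant into the last prime ([krull_dim_mpoly]). *)

Set Implicit Arguments.
Unset Strict Implicit.
Unset Printing Implicit Defensive.

Import GRing.Theory Order.TTheory.
Local Open Scope classical_set_scope.
Local Open Scope ring_scope.

(** * Submodules and ideals as closed sets *)

Section SubmoduleClosure.
Variables (R : comNzRingType) (V : lmodType R).
Implicit Types (A : set V) (r : R) (u v : V).

Lemma is_submoduleP A :
  is_submodule A <->
  A 0 /\ forall r u v, A u -> A v -> A (r *: u + v).
Proof.
have memA v : v \in [pred v in A] <-> A v by rewrite inE.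
split=> [[/memA A0 Alin]|[A0 Alin]]; split=> //; first 1 last.
- exact/memA.
- by move=> r u v /memA Au /memA Av; apply/memA/Alin.
- by move=> r u v /memA Au /memA Av; apply/memA/Alin.
Qed.

Lemma submodule0 A : is_submodule A -> A 0.
Proof. by case/is_submoduleP. Qed.

Lemma submoduleD A u v : is_submodule A -> A u -> A v -> A (u + v).
Proof.
by case/is_submoduleP=> _ Alin Au Av; rewrite -[u]scale1r; apply: Alin.
Qed.

Lemma submoduleZ A r u : is_submodule A -> A u -> A (r *: u).
Proof.
by case/is_submoduleP=> A0 Alin Au; rewrite -[_ *: _]addr0; apply: Alin.
Qed.

End SubmoduleClosure.

Section IdealTheory.
Variable R : comNzRingType.
Implicit Types (I J L P : set R) (r u v g : R) (gs w : seq R).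

(** Unlike [idealr_closed], this allows the unit ideal, which occurs as the
    colon ideal of an element of [M]. *)
Definition is_ideal I : Prop := is_submodule (I : set R^o).

Lemma ideal0 I : is_ideal I -> I 0.
Proof. exact: (@submodule0 R R^o). Qed.

Lemma idealD I u v : is_ideal I -> I u -> I v -> I (u + v).
Proof. exact: (@submoduleD R R^o). Qed.

Lemma idealMl I r u : is_ideal I -> I u -> I (r * u).
Proof. exact: (@submoduleZ R R^o). Qed.

Lemma idealMr I r u : is_ideal I -> I u -> I (u * r).
Proof. by rewrite mulrC; apply: idealMl. Qed.

Lemma idealB I u v : is_ideal I -> I u -> I v -> I (u - v).
Proof.
move=> idI Iu Iv; apply: idealD => //; rewrite -mulN1r.
exact: idealMl.
Qed.

Lemma ideal_sum I (T : Type) (s : seq T) (p : pred T) (F : T -> R) :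
  is_ideal I -> (forall i, p i -> I (F i)) -> I (\sum_(i <- s | p i) F i).
Proof.
move=> idI IF; elim/big_rec: _ => [|i x pi Ix]; first exact: ideal0.
by apply: idealD => //; apply: IF.
Qed.

Lemma is_idealP I :
  is_ideal I <-> I 0 /\ forall r u v, I u -> I v -> I (r * u + v).
Proof. exact: (@is_submoduleP R R^o). Qed.

Lemma is_prime_idealP P :
  is_prime_ideal P <->
  [/\ is_ideal P, ~ P 1 & forall u v, P (u * v) -> P u \/ P v].
Proof.
have memP r : r \in [pred r in P] <-> P r by rewrite inE.
split=> [[[/memP P0 /negP P1 Plin] Pmul]|[/is_idealP[P0 Plin] P1 Pmul]].
  split=> [|/memP//|u v /memP/Pmul /orP[] /memP]; [|by left|by right].
  apply/is_idealP; split=> // r u v /memP Pu /memP Pv.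
  exact/memP/Plin.
split; first split.
- exact/memP.
- by apply/negP => /memP.
- by move=> r u v /memP Pu /memP Pv; apply/memP/Plin.
- by move=> u v /memP /Pmul[] /memP ?; apply/orP; [left|right].
Qed.

Lemma prime_exp P r k : is_prime_ideal P -> P (r ^+ k) -> P r.
Proof.
case/is_prime_idealP=> _ P1 Pmul; elim: k => [|k IH]; first by rewrite expr0.
by rewrite exprS => /Pmul[].
Qed.

Lemma prime_prodN P (T : Type) (s : seq T) (F : T -> R) :
  is_prime_ideal P -> (forall i, ~ P (F i)) -> ~ P (\prod_(i <- s) F i).
Proof.
case/is_prime_idealP=> _ P1 Pmul PF; elim/big_rec: _ => // i x _ IH /Pmul[] //.
exact: PF.
Qed.

Lemma radical_ideal I : is_ideal I -> is_ideal (radical I).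
Proof.
move=> idI; apply/is_idealP; split; first by exists 1; apply: ideal0.
move=> r u v [k Iu] [l Iv]; exists (k + l)%N; rewrite exprDn.
apply: ideal_sum => // i _; rewrite -mulr_natl; apply: idealMl => //.
case: (leqP k (k + l - i)) => [le_k|lt_k].
  rewrite exprMn; apply: idealMr => //; apply: idealMl => //.
  by rewrite -(subnK le_k) exprD; apply: idealMl.
have le_l : (l <= i)%N by rewrite leqNgt; apply/negP => lt_l; move: lt_k;
  rewrite ltnNge -addnBA ?leq_addr // ltnW.
by apply: idealMl => //; rewrite -(subnK le_l) exprD; apply: idealMl.
Qed.

(** * Powers of finitely generated ideals *)

(** The ideal generated by [gs], as the intersection of the ideals containing
    it: membership is then used by choosing an ideal, never by handling
    coefficients. *)
Definition ideal_span gs : set R :=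
  [set r | forall I, is_ideal I -> (forall g, g \in gs -> I g) -> I r].

Lemma ideal_span_ideal gs : is_ideal (ideal_span gs).
Proof.
apply/is_idealP; split=> [I idI _|r u v Su Sv I idI gsI]; first exact: ideal0.
by apply: idealD => //; [apply: idealMl => //; apply: Su | apply: Sv].
Qed.

Lemma mem_ideal_span gs g : g \in gs -> ideal_span gs g.
Proof. by move=> ggs I _; apply. Qed.

Definition finitely_generated I : Prop :=
  exists2 gs, forall g, g \in gs -> I g & I `<=` ideal_span gs.

Definition noetherian : Prop := forall I, is_ideal I -> finitely_generated I.

Lemma transporter_ideal L r : is_ideal L -> is_ideal [set u | L (u * r)].
Proof.
move=> idL; apply/is_idealP; split=> [|a u v Lu Lv] /=.
  by rewrite mul0r; apply: ideal0.
by rewrite mulrDl -mulrA; apply: idealD => //; apply: idealMl.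
Qed.

(** [P^k] is generated by the words of length [k] in generators of [P].  The
    induction on [k] works for all [L] at once, because [P^(k+1) <= L] means
    that [P^k] lies in the transporter ideals of [L]. *)
Lemma ideal_exp_sub_words P gs k L :
  is_ideal L -> P `<=` ideal_span gs ->
  (forall w, size w = k -> {subset w <= gs} -> L (\prod_(g <- w) g)) ->
  ideal_exp P k `<=` L.
Proof.
move=> + Pgs; elim: k L => [|k IH] L idL wordsL r /=.
  move=> _; rewrite -[r]mulr1; apply: idealMl => //.
  by have := wordsL [::] erefl; rewrite big_nil; apply=> x; rewrite in_nil.
case=> t [f [h [Pf Ph ->]]]; apply: ideal_sum => // i _.
apply: (Pgs _ (Pf i) [set u | L (u * h i)]); first exact: transporter_ideal.
move=> g ggs /=; rewrite mulrC.
apply: (IH [set u | L (u * g)] _ _ _ (Ph i)); first exact: transporter_ideal.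
move=> w szw wgs /=; rewrite mulrC -(big_cons _ _ _ _ xpredT id).
apply: wordsL; first by rewrite /= szw.
by move=> x; rewrite inE => /orP[/eqP-> //|]; apply: wgs.
Qed.

Lemma size_le_sum_count (T : eqType) (s w : seq T) :
  {subset w <= s} -> (size w <= \sum_(x <- s) count_mem x w)%N.
Proof.
elim: w => [|y w IH] sub_ws //=; rewrite big_split /= -add1n; apply: leq_add.
  rewrite (eq_bigr (fun x => if pred1 y x then 1%N else 0%N)); last first.
    by move=> x _; rewrite /= eq_sym; case: eqP.
  rewrite -big_mkcond sum1_count -has_count; apply/hasP; exists y => //=.
  by apply: sub_ws; rewrite inE eqxx.
by apply: IH => x xw; apply: sub_ws; rewrite inE xw orbT.
Qed.

(** Pigeonhole: a word longer than [size gs * k] repeats some letter at least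
    [k] times. *)
Lemma prod_word_mem I gs w k :
  is_ideal I -> (forall g, g \in gs -> I (g ^+ k)) ->
  {subset w <= gs} -> (size gs * k < size w)%N -> I (\prod_(g <- w) g).
Proof.
move=> idI Igs sub_w lt_w.
have /hasP[g ggs le_k] : has (fun g => k <= count_mem g w)%N gs.
  apply: contraLR lt_w => /hasPn few; rewrite -leqNgt.
  apply: leq_trans (size_le_sum_count sub_w) _.
  elim: gs few {Igs sub_w} => [|g gs IH] few; first by rewrite big_nil.
  rewrite big_cons mulSn leq_add //; last first.
    by apply: IH => x xgs; apply: few; rewrite inE xgs orbT.
  by have := few g (mem_head g gs); rewrite -ltnNge => /ltnW.
rewrite (bigID (pred1 g)) /=; apply: idealMr => //.
rewrite (eq_bigr (fun=> g)) => [|x /eqP-> //].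
rewrite big_const_seq iter_mulr_1 -(subnK le_k) exprD.
by apply: idealMl => //; apply: Igs.
Qed.

Lemma uniform_exponent I gs :
  is_ideal I -> (forall g, g \in gs -> radical I g) ->
  exists k, forall g, g \in gs -> I (g ^+ k).
Proof.
move=> idI; elim: gs => [|g gs IH] gsI; first by exists 0%N.
have [k Ik] := IH (fun x xgs => gsI x (mem_behead (s := g :: gs) xgs)).
have [l Il] := gsI g (mem_head g gs).
exists (l + k)%N => x; rewrite inE exprD => /orP[/eqP->|/Ik ?].
  exact: idealMr.
exact: idealMl.
Qed.

(** The only place where finite generation of the prime matters: the exponent
    that brings an element of [P] into [I] becomes uniform. *)
Lemma radical_power_sub I P :
  is_ideal I -> finitely_generated P -> P `<=` radical I ->
  exists2 k, (1 <= k)%N & ideal_exp P k `<=` I.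
Proof.
move=> idI [gs gsP Pgs] PI.
have [k Ik] := uniform_exponent idI (fun g ggs => PI g (gsP g ggs)).
exists (size gs * k).+1 => //; apply: ideal_exp_sub_words Pgs _ => // w szw sub_w.
by apply: (prod_word_mem idI Ik sub_w); rewrite szw.
Qed.

Lemma expr_ideal_exp P r k : P r -> ideal_exp P k (r ^+ k).
Proof.
move=> Pr; elim: k => [//|k IH]; exists 1%N, (fun=> r), (fun=> r ^+ k).
by split=> //; rewrite big_ord_recl big_ord0 addr0 exprS.
Qed.

(** * Dimension and containment in a prime *)

(** If [d] is the largest length of a chain of primes above [P], and [I] is not
    contained in [P], a chain of length [d] above [P + I] would give one of
    length [d + 1] by adding [P] at its bottom.  Without a bound on the
    dimension the equivalence can fail, as both dimensions may be infinite. *)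
Lemma krull_dim_lt_addP P I :
  is_prime_ideal P -> is_ideal I -> (exists d, ~ krull_dim_ge P d) ->
  krull_dim_lt (ideal_add P I) P <-> exists2 r, I r & ~ P r.
Proof.
move=> prP idI [d0 dimP]; have /is_prime_idealP[idP _ _] := prP.
have subP : P `<=` ideal_add P I.
  by move=> r Pr; exists r => //; exists 0; [apply: ideal0 | rewrite addr0].
split.
  case=> d [geP geI]; apply: contrapT => nexr; apply: geI.
  suff -> : ideal_add P I = P by [].
  rewrite eqEsubset; split=> // _ [r Pr [t It <-]]; apply: idealD => //.
  by apply: contrapT => nPt; apply: nexr; exists t.
case=> r Ir nPr.
have ge0 : krull_dim_ge P 0 by exists (fun=> P); split=> [i _|i _ t|i].
(* The dimension of the quotient by P. *)
have [d geP ngeP] : exists2 d, krull_dim_ge P d & ~ krull_dim_ge P d.+1.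
  elim: d0 dimP => // d IH ndim.
  by have [/IH|/contrapT ge_d] := pselect (~ krull_dim_ge P d) => //; exists d.
exists d; split=> // -[p [prp subp incp]]; apply: ngeP.
exists (fun i => if i is j.+1 then p j else P); split.
- by case=> // i; apply: prp.
- by case=> [_|i /subp/(subset_trans subP)].
- case=> [_|i lti]; last exact: incp.
  rewrite properEneq; split; last exact: subset_trans (subp 0%N _).
  apply/eqP => eqP0; apply: nPr; rewrite eqP0; apply: (subp 0%N) => //.
  by exists 0; [exact: ideal0 | exists r; rewrite ?add0r].
Qed.

End IdealTheory.

(** * Primary submodules *)

Section PrimaryTheory.
Variables (R : comNzRingType) (V : lmodType R).
Implicit Types (A B M N Q : set V) (P : set R) (r : R) (b v : V).

Lemma colon_ideal M b : is_submodule M -> is_ideal (colon M b).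
Proof.
move=> sM; apply/is_idealP; rewrite /colon; split=> /= [|r u v Mu Mv].
  by rewrite scale0r; apply: submodule0.
by rewrite scalerDl -scalerA; apply: submoduleD => //; apply: submoduleZ.
Qed.

Lemma ann_quotient_ideal B N : is_submodule N -> is_ideal (ann_quotient B N).
Proof.
move=> sN; apply/is_idealP; rewrite /ann_quotient; split=> /= [v _|r x y Nx Ny v Bv].
  by rewrite scale0r; apply: submodule0.
rewrite scalerDl -scalerA.
by apply: submoduleD => //; [apply: submoduleZ => //; apply: Nx | apply: Ny].
Qed.

Lemma primary_submodule B P N : is_P_primary B P N -> is_submodule N.
Proof. by case=> -[]. Qed.

Lemma primary_sub B P N : is_P_primary B P N -> N `<=` B.
Proof. by case=> -[_ []]. Qed.

Lemma primary_cancel B P N r v :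
  is_P_primary B P N -> B v -> N (r *: v) -> ~ P r -> N v.
Proof. by case=> -[_ _ Nprim] -> Bv /(Nprim _ _ Bv)[]. Qed.

Lemma primary_exp B P N r :
  is_P_primary B P N -> P r -> exists k, ann_quotient B N (r ^+ k).
Proof. by case=> _ ->. Qed.

Lemma primary_prime B P N :
  is_submodule B -> is_P_primary B P N -> is_prime_ideal P.
Proof.
move=> sB prN; have [[sN [_ nBN] Nprim] defP] := prN.
apply/is_prime_idealP; split.
- by rewrite defP; apply/radical_ideal/ann_quotient_ideal.
- move=> /(primary_exp prN)[k]; rewrite expr1n => annN.
  by apply: nBN => v Bv; rewrite -[v]scale1r; apply: annN.
move=> x y /(primary_exp prN)[k]; rewrite exprMn => annN.
have [annNy|/existsNP[v /not_implyP[Bv nNv]]] :=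
  pselect (ann_quotient B N (y ^+ k)).
  by right; rewrite defP; exists k.
left; rewrite defP.
have Byv : B (y ^+ k *: v) by apply: submoduleZ.
have := annN v Bv; rewrite -scalerA => /(Nprim _ _ Byv)[//|[l annNx]].
by exists (k * l)%N; rewrite exprM.
Qed.

(** This recovers the prime of a component [N] from [M] alone, as soon as some
    [b] outside [N] lies in all the other components. *)
Lemma radical_colon B P M N b :
  is_submodule B -> is_P_primary B P N -> B b -> ~ N b ->
  (forall r, M (r *: b) <-> N (r *: b)) -> radical (colon M b) = P.
Proof.
move=> sB prN Bb nNb eqMN; have prP := primary_prime sB prN.
rewrite eqEsubset; split=> r.
  case=> k /eqMN Nb; apply: contrapT => nPr; apply: nNb.
  by apply: (primary_cancel prN Bb Nb) => /(prime_exp prP).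
by case/(primary_exp prN)=> k annN; exists k; apply/eqMN/annN.
Qed.

Lemma localizationP B M P b :
  is_submodule M -> is_prime_ideal P -> (exists d, ~ krull_dim_ge P d) ->
  localization B M P b <-> B b /\ exists2 r, M (r *: b) & ~ P r.
Proof.
move=> sM prP dimP.
have := krull_dim_lt_addP prP (colon_ideal b sM) dimP.
by rewrite /localization /= => ->.
Qed.

End PrimaryTheory.

(** * Localization and primary decompositions *)

Section PrimaryComponent.
Variables (R : comNzRingType) (V : lmodType R).
Variables (B M : set V) (P : set R).
Hypotheses (sB : is_submodule B) (sM : is_submodule M) (MB : M `<=` B).
Hypothesis dimP : exists d, ~ krull_dim_ge P d.

Local Notation MP := (localization B M P).

Lemma localization_sub_primary P' N :
  is_prime_ideal P ->
  is_P_primary B P' N -> M `<=` N -> P' `<=` P -> MP `<=` N.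
Proof.
move=> prP prN MN PP b /(localizationP B b sM prP dimP)[Bb [r Mrb nPr]].
by apply: (primary_cancel prN Bb (MN _ Mrb)) => /PP.
Qed.

Lemma sub_localization : is_prime_ideal P -> M `<=` MP.
Proof.
move=> prP b Mb; apply/(localizationP B b sM prP dimP); split; first exact: MB.
by exists 1; [rewrite scale1r | case/is_prime_idealP: prP].
Qed.

(** Each [Q_j] with [P_j] not contained in [P] is reached from [B] by a
    multiplier outside [P], a power of an element of [P_j]; the product of
    these multipliers is still outside [P]. *)
Lemma mem_localization m (Qs : 'I_m -> set V) (Ps : 'I_m -> set R) b :
  is_prime_ideal P ->
  is_primary_decomposition B M Qs Ps -> B b ->
  (forall j, Ps j `<=` P -> Qs j b) -> MP b.
Proof.
move=> prP [prQs defM] Bb Qb; apply/(localizationP B b sM prP dimP); split=> //.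
have /choice[s sP] : forall j, exists s, ~ P s /\ Qs j (s *: b).
  move=> j; have [sub|/existsNP[r /not_implyP[Pjr nPr]]] :=
    pselect (Ps j `<=` P).
    exists 1; rewrite scale1r; split; last exact: Qb.
    by case/is_prime_idealP: prP.
  have [k annQ] := primary_exp (prQs j) Pjr.
  by exists (r ^+ k); split; [move=> /(prime_exp prP) | apply: annQ].
exists (\prod_j s j); last by apply: prime_prodN => // j; have [] := sP j.
rewrite defM; split; first exact: submoduleZ.
move=> j _; rewrite (bigD1 j) //= mulrC -scalerA.
by apply: submoduleZ; [exact: primary_submodule (prQs j) | have [] := sP j].
Qed.

(** A prime [P_j] strictly below [P] omits some element of [P], whose powers can
    be cancelled modulo [Q_j]; so saturating [MP] by [P] can only lose the
    component at [P] itself. *)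
Lemma component_cap_saturation m (Qs : 'I_m -> set V) (Ps : 'I_m -> set R) k :
  is_primary_decomposition B M Qs Ps -> injective Ps -> Ps k = P ->
  Qs k `&` saturation B MP P = MP.
Proof.
move=> dec injPs defP; have [prQs defM] := dec.
have prk := prQs k; rewrite defP in prk; have prP := primary_prime sB prk.
have MQ j : M `<=` Qs j by move=> b; rewrite defM => -[_]; apply.
have idMP r b : MP b -> MP (r *: b).
  case/(localizationP B b sM prP dimP)=> Bb [t Mtb nPt].
  apply/(localizationP B _ sM prP dimP); split; first exact: submoduleZ.
  by exists t => //; rewrite scalerA mulrC -scalerA; apply: submoduleZ.
rewrite eqEsubset; split=> b; last first.
  move=> MPb; split; first exact: (localization_sub_primary prP prk).
  split; first by case: MPb.
  by exists 1%N; split=> // r _; apply: idMP.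
case=> Qkb [Bb [e [_ satb]]]; apply: (mem_localization prP dec Bb) => j PjP.
have [->//|nejk] := eqVneq j k.
have [r Pr nPjr] : exists2 r, P r & ~ Ps j r.
  apply: contrapT => nex; move/eqP: nejk; apply; apply: injPs; rewrite defP.
  rewrite eqEsubset; split=> // r Pr; apply: contrapT => nPjr.
  by apply: nex; exists r.
apply: (@primary_cancel _ _ _ _ _ (r ^+ e) _ (prQs j) Bb).
  apply: (localization_sub_primary prP (prQs j) (MQ j) PjP).
  exact/satb/expr_ideal_exp.
by move=> /(prime_exp (primary_prime sB (prQs j))).
Qed.

(** Irredundance gives [b] in every [Q_j] with [j != i] but not in [Q_i]; the
    radical of [(M : b)] is then the prime of the remaining component in both
    decompositions. *)
Lemma primary_component_prime m (Qs : 'I_m -> set V) (Ps : 'I_m -> set R) Q i :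
  is_irredundant_primary_decomposition B M Qs Ps ->
  is_P_primary B P Q ->
  M = Q `&` \bigcap_(j in [set j | j != i]) Qs j -> Ps i = P.
Proof.
move=> [[prQs defM] irr _] prQ defM'.
have /existsNP[b /not_implyP[[Bb Qjb] nQib]] := irr i.
have capb r j : j != i -> Qs j (r *: b).
  by move=> neji; apply: submoduleZ (Qjb j neji); apply: primary_submodule (prQs j).
have eqM r : M (r *: b) <-> Qs i (r *: b).
  rewrite defM; split=> [[_]|Qib]; first exact.
  split=> [|j _]; first exact: submoduleZ.
  by have [->|/capb] := eqVneq j i.
have eqM' r : M (r *: b) <-> Q (r *: b).
  by rewrite defM'; split=> [[]//|Qb]; split=> // j; apply: capb.
rewrite -(radical_colon sB (prQs i) Bb nQib eqM).
apply: (radical_colon sB prQ Bb _ eqM') => Qb; apply: nQib.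
by rewrite -[b]scale1r; apply/eqM/eqM'; rewrite scale1r.
Qed.

(** For the converse, [P^e] maps [B] into [Q_k], which puts every [b] that lies
    in the other components into the saturation of [MP]; this is where [Q] and
    the saturation together detect the missing component. *)
Theorem primary_component_iff m (Qs : 'I_m -> set V) (Ps : 'I_m -> set R) Q k :
  finitely_generated P ->
  is_irredundant_primary_decomposition B M Qs Ps -> P = Ps k ->
  is_P_primary B P Q -> M `<=` Q ->
  (exists i, M = Q `&` \bigcap_(j in [set j | j != i]) Qs j)
  <-> Q `&` saturation B MP P = MP.
Proof.
move=> fgP irrdec defP prQ MQ; have [dec _ injPs] := irrdec.
have [prQs defM] := dec.
have prP := primary_prime sB prQ.
split.
  case=> i defM'; have := primary_component_prime irrdec prQ defM'.
  rewrite defP => /injPs eik; rewrite {i}eik in defM'.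
  (* The decomposition in which Q takes the place of the k-th component. *)
  pose Qs' j := if j == k then Q else Qs j.
  have defQ : Qs' k = Q by rewrite /Qs' eqxx.
  rewrite -defP -defQ; apply: component_cap_saturation injPs (esym defP).
  split=> [j|].
    by rewrite /Qs'; case: eqVneq => [->|_] //; rewrite -defP.
  rewrite defM' eqEsubset; split=> b.
    case=> Qb Qjb; split; first exact: primary_sub prQ _ Qb.
    by move=> j _; rewrite /Qs'; case: eqVneq => // /Qjb.
  case=> _ Qjb; split; first by rewrite -defQ; apply: Qjb.
  by move=> j /= nejk; have := Qjb j I; rewrite /Qs' (negPf nejk).
move=> satQ; exists k; rewrite eqEsubset; split=> b.
  move=> Mb; split; first exact: MQ.
  by move=> j _; move: Mb; rewrite defM => -[_]; apply.
case=> Qb Qjb; have Bb := primary_sub prQ Qb.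
have prk := prQs k; rewrite -defP in prk.
have Mk : M `<=` Qs k by move=> c; rewrite defM => -[_]; apply.
suff Qkb : Qs k b.
  by rewrite defM; split=> // j _; have [->//|/Qjb] := eqVneq j k.
apply: (localization_sub_primary prP prk Mk) => //.
rewrite -satQ; split=> //; split=> //.
have sQk := primary_submodule prk.
have [e e1 annQ] :
  exists2 e, (1 <= e)%N & ideal_exp P e `<=` ann_quotient B (Qs k).
  apply: radical_power_sub fgP _; first exact: ann_quotient_ideal.
  by case: prk => _ {1}->.
exists e; split=> // r Per; apply: sub_localization => //.
rewrite defM; split; first exact: submoduleZ.
move=> j _; have [->|nejk] := eqVneq j k; first exact: (annQ _ Per).
by apply: submoduleZ; [apply: primary_submodule (prQs j) | apply: Qjb].
Qed.

End PrimaryComponent.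

(** * Dickson's lemma *)

(** Repeatedly take an index at which [u] is minimal among the later ones. *)
Lemma nondecreasing_subsequence (u : nat -> nat) :
  exists phi : nat -> nat,
    {homo phi : i j / (i < j)%N} /\ {homo u \o phi : i j / (i <= j)%N}.
Proof.
have min_after N : exists m, (N <= m)%N /\ forall j, (N <= j)%N -> (u m <= u j)%N.
  pose v j := `[< exists2 i, (N <= i)%N & u i = j >].
  have exv : exists j, v j by exists (u N); apply/asboolP; exists N.
  case: (ex_minnP exv) => _ /asboolP[m leNm <-] minm; exists m; split=> // j leNj.
  by apply: minm; apply/asboolP; exists j.
have {min_after} [s sP] := choice min_after.
pose phi := fix phi k := if k is k'.+1 then s (phi k').+1 else s 0%N.
have phi_min k j : (phi k <= j)%N -> (u (phi k) <= u j)%N.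
  case: k => [|k] le_j /=; first by have [_] := sP 0%N; apply.
  have [lek] := sP (phi k).+1; apply; exact: leq_trans lek le_j.
have phi_lt : {homo phi : i j / (i < j)%N}.
  by apply: homo_ltn; [exact: ltn_trans | move=> i; have [] := sP (phi i).+1].
exists phi; split=> // i j; rewrite leq_eqVlt => /orP[/eqP-> //|/phi_lt lt_ij].
by apply: phi_min; apply: ltnW.
Qed.

(** Extract subsequences successively, making one more exponent nondecreasing
    each time. *)
Lemma dickson n (a : nat -> 'X_{1..n}) :
  exists i j, (i < j)%N /\ (a i <= a j)%MM.
Proof.
have prefix k : exists phi : nat -> nat,
    {homo phi : i j / (i < j)%N} /\
    forall l : 'I_n, (l < k)%N ->
      {homo (fun i => a (phi i) l) : i j / (i <= j)%N}.
  elim: k => [|k [phi [phi_lt phi_le]]]; first by exists id; split=> [i j|l].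
  case: (ltnP k n) => [ltkn|lenk]; last first.
    by exists phi; split=> // l _; apply/phi_le/(leq_trans (ltn_ord l)).
  have [psi [psi_lt psi_le]] :=
    nondecreasing_subsequence (fun i => a (phi i) (Ordinal ltkn)).
  exists (phi \o psi); split=> [i j /psi_lt/phi_lt //|l].
  rewrite ltnS leq_eqVlt => /orP[/eqP eqlk|ltlk] i j leij /=.
    have -> : l = Ordinal ltkn by apply: val_inj.
    exact: psi_le.
  apply: (phi_le l ltlk).
  by move: leij; rewrite leq_eqVlt => /orP[/eqP-> //|/psi_lt/ltnW].
have [phi [phi_lt phi_le]] := prefix n.
exists (phi 0%N), (phi 1%N); split; first exact: phi_lt.
by apply/mnm_lepP => l; apply: phi_le.
Qed.

(** * Hilbert's basis theorem *)

Section HilbertBasis.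
Variables (K : fieldType) (n : nat).
Local Notation S := {mpoly K[n]}.

Lemma mlead_cancel (f g : S) :
  f != 0 -> g != 0 -> (mlead f <= mlead g)%MM ->
  exists h, g - h * f = 0 \/ (mlead (g - h * f) < mlead g)%O.
Proof.
move=> f0 g0 le_fg.
set c := mleadc g / mleadc f; set h : S := c *: 'X_[mlead g - mlead f].
have lcf : mleadc f != 0 by rewrite mleadc_eq0.
have lcg : mleadc g != 0 by rewrite mleadc_eq0.
have c0 : c != 0 by rewrite mulf_neq0 ?invr_eq0.
have h0 : h != 0.
  apply: contraNneq c0 => h0.
  have := mcoeffZ c 'X_[mlead g - mlead f] (mlead g - mlead f).
  by rewrite -/h h0 mcoeff0 mcoeffX eqxx mulr1 => <-.
have lh : mlead h = (mlead g - mlead f)%MM by rewrite mleadZ // mleadXm.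
have lhf : mlead (h * f) = mlead g by rewrite mleadM // lh submK.
exists h; have [->|d0] := eqVneq (g - h * f) 0; [by left | right].
rewrite lt_neqAle; apply/andP; split; last first.
  by have := mleadB_le g (h * f); rewrite lhf joinxx.
apply: contraNneq d0 => eq_lead; rewrite -mleadc_eq0 eq_lead mcoeffB.
have -> : (h * f)@_(mlead g) = mleadc h * mleadc f.
  by rewrite -lhf mleadM // mleadcM.
by rewrite /h mleadcZE mleadXm mcoeffX eqxx mulr1 divfK // subrr.
Qed.

(** Otherwise pick [f 0, f 1, ...] in [J], each one with minimal leading monomial
    outside the ideal spanned by the previous ones.  Dickson's lemma yields
    [i < j] such that the leading monomial of [f i] divides that of [f j];
    subtracting a multiple of [f i] from [f j] lowers the leading monomial but
    stays outside the span, which contradicts minimality. *)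
Theorem mpoly_noetherian : noetherian S.
Proof.
move=> J idJ; apply: contrapT => nfg.
have next (gs : seq S) : exists f, (forall g, g \in gs -> J g) ->
  [/\ J f, ~ ideal_span gs f &
      forall h, J h -> ~ ideal_span gs h -> (mlead f <= mlead h)%O].
  have [gsJ|] := pselect (forall g, g \in gs -> J g); last by exists 0.
  have [f [Jf nf]] : exists f, J f /\ ~ ideal_span gs f.
    apply: contrapT => /forallNP nex; apply: nfg; exists gs => // f Jf.
    by apply: contrapT => nf; apply: (nex f).
  have {f Jf nf} : exists f, [/\ J f, ~ ideal_span gs f &
      forall h, J h -> ~ ideal_span gs h -> (mlead f <= mlead h)%O].
    elim/(@mleadrect n K): f Jf nf => f IH Jf nf.
    have [minf|/existsNP[h]] := pselect
      (forall h, J h -> ~ ideal_span gs h -> (mlead f <= mlead h)%O).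
      by exists f.
    move=> /not_implyP[Jh /not_implyP[nh /negP]]; rewrite -ltNge => lt_hf.
    exact: (IH h).
  by case=> f fP; exists f.
have {next} [F FP] := choice next.
(* gen k lists f 0, ..., f (k - 1). *)
pose gen := fix gen k := if k is k'.+1 then F (gen k') :: gen k' else [::].
pose f k := F (gen k).
have genJ k g : g \in gen k -> J g.
  elim: k g => [//|k IH] g; rewrite inE => /orP[/eqP->|/IH //].
  by have [] := FP _ IH.
have {}FP k : [/\ J (f k), ~ ideal_span (gen k) (f k) &
    forall h, J h -> ~ ideal_span (gen k) h -> (mlead (f k) <= mlead h)%O].
  exact: FP _ (genJ k).
have gen_mem i j : (i < j)%N -> f i \in gen j.
  elim: j => // j IH; rewrite ltnS leq_eqVlt inE => /orP[/eqP->|/IH->].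
    by rewrite eqxx.
  by rewrite orbT.
have f0 k : f k != 0.
  have [_ nf _] := FP k; apply/eqP => fk0; apply: nf; rewrite fk0.
  exact: ideal0 (ideal_span_ideal _).
have [i [j [ltij le_lead]]] := dickson (fun k => mlead (f k)).
have [h hP] := mlead_cancel (f0 i) (f0 j) le_lead.
have [Ji _ _] := FP i; have [Jj nj minj] := FP j.
have idS := @ideal_span_ideal S (gen j).
have Sh : ideal_span (gen j) (h * f i).
  exact: idealMl idS (mem_ideal_span (gen_mem _ _ ltij)).
have nd : ~ ideal_span (gen j) (f j - h * f i).
  by move=> Sd; apply: nj; rewrite -[f j](subrK (h * f i)); exact: idealD idS Sd Sh.
case: hP => [d0|lt_lead]; first by apply: nd; rewrite d0; exact: ideal0 idS.
have : (mlead (f j) <= mlead (f j - h * f i))%O.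
  by apply: minj => //; exact: idealB idJ Jj (idealMl _ idJ Ji).
by rewrite leNgt lt_lead.
Qed.

End HilbertBasis.

(** * Krull dimension of polynomial rings *)

(** [c a] and [e a] are the coefficient and the exponents of the term [a] of a
    polynomial relation.  Among the terms, keep those with the least exponent
    [m] of [x i]: [x i ^+ m] can be divided out because [x i] is not in the
    prime [p i], and afterwards the other terms vanish modulo [p i.+1] because
    [x i] belongs to it.  At the end of the chain a single coefficient is left,
    and it belongs to the last prime. *)
Lemma prime_chain_lowest_term (R : comNzRingType) (E : finType)
    (d : nat) (p : nat -> set R) (x : nat -> R)
    (c : E -> R) (e : E -> nat -> nat) (i : nat) (A : {set E}) :
  (forall j, (j <= d)%N -> is_prime_ideal (p j)) ->
  (forall j, (j < d)%N -> p j `<=` p j.+1) ->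
  (forall j, (j < d)%N -> p j.+1 (x j) /\ ~ p j (x j)) ->
  (forall a, a \in A -> ~ p d (c a)) ->
  (i <= d)%N -> A != finset.set0 ->
  {in A &, forall a b, (forall j, (i <= j < d)%N -> e a j = e b j) -> a = b} ->
  ~ p i (\sum_(a in A) c a * \prod_(i <= j < d) x j ^+ e a j).
Proof.
move=> prp incp px; move def_l: (d - i)%N => l.
elim: l i A def_l => [|l IH] i A def_l cA le_id /set0Pn[a0 a0A] injA.
  have eid : i = d by apply/eqP; rewrite eqn_leq le_id -subn_eq0 def_l.
  rewrite eid in injA *.
  have -> : A = [set a0]%SET.
    apply/setP => a; rewrite finset.inE; apply/idP/eqP => [aA|-> //].
    by apply: injA => // j /andP[ledj]; rewrite ltnNge ledj.
  by rewrite big_set1 big_geq // mulr1; apply: cA.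
have lt_id : (i < d)%N by rewrite -subn_gt0 def_l.
case: (arg_minnP (fun a => e a i) a0A) => m mA minm.
have [pxi npxi] := px i lt_id.
have /is_prime_idealP[idpi _ mulpi] := prp i le_id.
have /is_prime_idealP[idpi1 _ _] := prp i.+1 lt_id.
pose rest a := \prod_(i.+1 <= j < d) x j ^+ e a j.
move=> sumA.
have {sumA} sumA : p i (\sum_(a in A) c a * (x i ^+ (e a i - e m i) * rest a)).
  have : p i (x i ^+ e m i * \sum_(a in A) c a * (x i ^+ (e a i - e m i) * rest a)).
    rewrite big_distrr /=; congr (p i _): sumA; apply: eq_bigr => a aA.
    rewrite big_ltn // [RHS]mulrCA; congr (_ * _).
    by rewrite mulrA -exprD subnKC //; apply: minm.
  by case/mulpi => // /(prime_exp (prp i le_id)).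
pose A' := [set a in A | e a i == e m i]%SET.
apply: (IH i.+1 A'); rewrite ?subnS ?def_l //.
- by move=> a; rewrite finset.inE => /andP[/cA].
- by apply/set0Pn; exists m; rewrite finset.inE; apply/andP.
- move=> a b; rewrite !finset.inE => /andP[aA /eqP ea] /andP[bA /eqP eb] eqab.
  apply: injA => // j; rewrite leq_eqVlt => /andP[/orP[/eqP<-|ltij] ltjd].
    by rewrite ea eb.
  by apply: eqab; rewrite ltij.
have := incp i lt_id _ sumA.
rewrite (bigID (fun a => e a i == e m i)) /= => sumA1.
set low := (X in p i.+1 X); set high := (X in _ + X) in sumA1.
have phigh : p i.+1 high.
  apply: ideal_sum => // a /andP[aA nea].
  have lt_e : (e m i < e a i)%N by rewrite ltn_neqAle eq_sym nea; apply: minm.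
  rewrite -subn_gt0 in lt_e; rewrite -(prednK lt_e) exprS.
  by apply: idealMl => //; apply: idealMr => //; apply: idealMr.
have := idealB idpi1 sumA1 phigh; rewrite addrK.
congr (p i.+1 _); rewrite /low; apply: eq_big => [a|a /andP[_ /eqP->]].
  by rewrite finset.inE.
by rewrite subnn expr0 mul1r.
Qed.

Section AlgebraicDependence.
Variables (K : fieldType) (n : nat).
Local Notation S := {mpoly K[n]}.

(** Polynomials of degree less than [N] only involve the [N ^ n] monomials whose
    exponents are less than [N]. *)
Lemma linear_dependence_bounded_degree (E : finType) N (F : E -> S) :
  (forall a, (msize (F a) <= N)%N) -> (N ^ n < #|E|)%N ->
  exists2 c : E -> K, (exists a, c a != 0) & \sum_a (c a)%:MP * F a = 0.
Proof.
move=> szF ltE.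
pose mon (f : {ffun 'I_n -> 'I_N}) : 'X_{1..n} := [multinom f l : nat | l < n].
pose A : 'M[K]_(#|E|, #|{: {ffun 'I_n -> 'I_N}}|) :=
  \matrix_(i, j) (F (enum_val i))@_(mon (enum_val j)).
have : kermx A != 0.
  rewrite -mxrank_eq0 mxrank_ker subn_eq0 -ltnNge.
  by rewrite (leq_ltn_trans (rank_leq_col A)) // card_ffun !card_ord.
case/rowV0Pn=> c /sub_kermxP cA c0.
exists (fun a => c 0 (enum_rank a)).
  have /rV0Pn[i ci] := c0; exists (enum_val i).
  by rewrite enum_valK.
apply/mpolyP => mm; rewrite mcoeff0 raddf_sum /=.
under eq_bigr do rewrite mcoeffCM.
case: (ltnP (mdeg mm) N) => [lt_mN|le_Nm]; last first.
  rewrite big1 // => a _; rewrite (memN_msupp_eq0 (p := F a)) ?mulr0 //.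
  exact/msize_mdeg_ge/(leq_trans (szF a)).
have ltm l : (mm l < N)%N.
  by apply: leq_ltn_trans lt_mN; rewrite mdegE (bigD1 l) //= leq_addr.
pose f : {ffun 'I_n -> 'I_N} := [ffun l => Ordinal (ltm l)].
have monf : mon f = mm by apply/mnmP => l; rewrite mnmE ffunE.
move/matrixP/(_ 0 (enum_rank f)): cA; rewrite !mxE => cAf.
rewrite -[RHS]cAf (reindex (@enum_val E E)) /=; last exact/onW_bij/enum_val_bij.
by apply: eq_bigr => i _; rewrite mxE !enum_valK enum_rankK monf.
Qed.

Lemma msize_prod_exp_le d D e0 (x : nat -> S) (e : nat -> nat) :
  (forall j, (j < d)%N -> (msize (x j) <= e0.+1)%N) ->
  (forall j, (j < d)%N -> (e j <= D)%N) ->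
  (msize (\prod_(0 <= j < d) x j ^+ e j) <= (d * (D * e0)).+1)%N.
Proof.
move=> szx eD; elim: d szx eD => [|d IH] szx eD.
  by rewrite big_geq // msize1.
have mszM (p q : S) a b : (msize p <= a.+1)%N -> (msize q <= b.+1)%N ->
    (msize (p * q) <= (a + b).+1)%N.
  have [->|p0] := eqVneq p 0; first by rewrite mul0r msize0.
  have [->|q0] := eqVneq q 0; first by rewrite mulr0 msize0.
  move=> sp sq; rewrite msizeM //.
  rewrite -ltnS prednK ?addn_gt0 ?[(0 < msize p)%N]lt0n ?msize_poly_eq0 ?p0 //.
  by apply: leq_trans (leq_add sp sq) _; rewrite addSn addnS.
rewrite big_nat_recr //= mulSn addnC; apply: (@mszM _ _).
  by apply: IH => j ltj; [apply: szx | apply: eD]; apply: ltnW.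
have szX k : (msize (x d ^+ k) <= (k * e0).+1)%N.
  elim: k => [|k IHk]; first by rewrite expr0 msize1.
  by rewrite exprS mulSn; apply: (@mszM _ _) IHk; apply: szx.
by apply: leq_trans (szX _) _; rewrite ltnS leq_mul2r eD // orbT.
Qed.

(** The [D ^ n.+1] monomials in the [x j] with exponents less than [D] have
    degree less than [C * D] for a constant [C], hence lie in a space of
    dimension [(C * D) ^ n], which is smaller than [D ^ n.+1] as soon as
    [D > C ^ n]. *)
Lemma algebraic_dependence (x : nat -> S) :
  exists D (c : {ffun 'I_n.+1 -> 'I_D} -> K), (exists a, c a != 0) /\
    \sum_a (c a)%:MP * \prod_(0 <= j < n.+1) x j ^+ a (inord j) = 0.
Proof.
pose e0 := (\max_(j < n.+1) msize (x j))%N.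
pose C := (n.+1 * e0).+1%N; pose D := (C ^ n).+1.
pose F (a : {ffun 'I_n.+1 -> 'I_D}) : S :=
  \prod_(0 <= j < n.+1) x j ^+ a (inord j).
have szF a : (msize (F a) <= C * D)%N.
  apply: leq_trans (_ : (n.+1 * (D * e0)).+1 <= _)%N.
    apply: msize_prod_exp_le => j ltj; last exact/ltnW/ltn_ord.
    by rewrite leqW // (leq_bigmax (Ordinal ltj)).
  have -> : (n.+1 * (D * e0) = n.+1 * e0 * D)%N by rewrite mulnA mulnAC.
  by rewrite -[X in (X <= _)%N]add1n [leqRHS]mulSn leq_add2r.
have [|c c0 cF] := linear_dependence_bounded_degree szF; last by exists D, c.
by rewrite card_ffun !card_ord expnMn expnS ltn_pmul2r ?expn_gt0.
Qed.

Theorem krull_dim_mpoly (I : set S) : ~ krull_dim_ge I n.+1.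
Proof.
case=> p [prp _ incp].
have /choice[x px] j : exists x, (j < n.+1)%N -> p j.+1 x /\ ~ p j x.
  case: (ltnP j n.+1) => [ltj|]; last by exists 0.
  have [_ /existsNP[x /not_implyP[px npx]]] := incp j ltj.
  by exists x.
have [D [c [[a0 ca0] sum0]]] := algebraic_dependence x.
pose A := [set a | c a != 0]%SET.
apply: (@prime_chain_lowest_term S _ n.+1 p x (fun a => (c a)%:MP)
  (fun a j => a (inord j)) 0%N A) => //.
- by move=> j /incp[].
- move=> a; rewrite finset.inE => ca pca.
  have /is_prime_idealP[idp np1 _] := prp n.+1 (leqnn _).
  apply: np1; rewrite -mpolyC1 -(mulVf ca) mpolyCM; exact: idealMl.
- by apply/set0Pn; exists a0; rewrite finset.inE.
- move=> a b _ _ eqab; apply/ffunP => l; apply: val_inj.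
  by have := eqab l; rewrite /= ltn_ord inord_val; apply.
have /is_prime_idealP[idp0 _ _] := prp 0%N isT.
rewrite (_ : \sum_(a in A) _ = 0); first exact: ideal0.
rewrite -[RHS]sum0 [RHS](bigID (mem A)) /= [X in _ + X]big1 ?addr0 // => a.
by rewrite finset.inE negbK => /eqP->; rewrite mpolyC0 mul0r.
Qed.

End AlgebraicDependence.

(** * Primary components over a polynomial ring *)

Theorem theorem2p10 (n s : nat) (B M : set 'rV[{mpoly rat[n]}]_s)
  (hB : is_submodule B) (hM : is_submodule M) (hMB : M `<=` B)
  (m : nat) (Qs : 'I_m -> set 'rV[{mpoly rat[n]}]_s)
  (Ps : 'I_m -> set {mpoly rat[n]})
  (hdec : is_irredundant_primary_decomposition B M Qs Ps)
  (P : set {mpoly rat[n]}) (hP : exists k : 'I_m, P = Ps k)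
  (Q : set 'rV[{mpoly rat[n]}]_s) (hQ : is_P_primary B P Q) (hMQ : M `<=` Q) :
  (exists i : 'I_m, M = Q `&` \bigcap_(j in [set j | j != i]) Qs j)
  <-> Q `&` saturation B (localization B M P) P = localization B M P.
Proof.
have [k defP] := hP.
have /is_prime_idealP[idP _ _] := primary_prime hB hQ.
apply: (primary_component_iff hB hM hMB) hdec defP hQ hMQ.
  by exists n.+1; apply: krull_dim_mpoly.
exact: mpoly_noetherian.
Qed.
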